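(* Let $d=d(n)$ be a positive integer-valued function of $n$ with $d=O(\log n)$, and put $\lambda=d^2+d$. Let $\pi\in\mathfrak{S}_n$ be chosen uniformly at random. Then \[ \Pr{d(\pi)\geq d+2}=e^{-\lambda}+O\!\left(\frac{(\log n)^6e^{\lambda}}{n}\right) \] as $n\to\infty$.
   Context: $[n]=\{1,\dots,n\}$ and $\mathfrak{S}_n$ is the set of permutations of $[n]$. For $\pi\in\mathfrak{S}_n$ ($n\ge 2$), the minimum Manhattan distance is $d(\pi)=\min_{1\le i<j\le n}\big(|i-j|+|\pi(i)-\pi(j)|\big)$ (the minimum $L^1$ distance between two distinct points of the graph $\{(i,\pi(i))\}$ of $\pi$). *)

(* Defs.v *)
From Stdlib Require Import Reals.
From mathcomp Require Import all_boot all_fingroup.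

Set Implicit Arguments.
Unset Strict Implicit.
Unset Printing Implicit Defensive.

Definition absdiff (a b : nat) : nat := (a - b) + (b - a).

Definition mdist n (p : 'S_n) (i j : 'I_n) : nat :=
  absdiff i j + absdiff (p i) (p j).

(* d(p) = min_{i<j} (|i-j| + |p(i)-p(j)|).  The neutral element 2n exceeds
   every such distance (each is <= 2n-2), so for n >= 2 this is exactly
   the minimum over all pairs i < j. *)
Definition min_manhattan n (p : 'S_n) : nat :=
  \big[minn/(2 * n)%N]_(i < n) \big[minn/(2 * n)%N]_(j < n | (i < j)%N) mdist p i j.

Definition prob_dist_ge (n k : nat) : R :=
  Rdiv (INR #|[set p : 'S_n | (k <= min_manhattan p)%N]|) (INR #|[set: 'S_n]|).

(* Main.v *)
Require Import Defs.
From Stdlib Require Import Reals Lra.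
From mathcomp Require Import all_boot all_order all_algebra all_fingroup.
From mathcomp Require Import zify Rstruct.

Set Implicit Arguments.
Unset Strict Implicit.
Unset Printing Implicit Defensive.

(** Call a pair of positions bad if its Manhattan distance is at most d + 1,
    let W(p) be the number of bad pairs of p, and put P(s) = sum_p s^W(p), so
    that P(1) = n! and P(0) counts the permutations with W = 0.  If
    |P' - lam P| <= e n! on [0, 1], the mean value theorem applied to
    exp (- lam s) P(s) gives |Pr(W = 0) - exp (- lam)| <= e.

    To bound P' - lam P, fix i < j and let p range over S_n.  Exchanging the
    values of p at j and k turns a permutation for which (p i, p k) is a bad
    offset for (i, j) into one for which (i, j) is a bad pair, and each such
    permutation arises n - 1 times.  So (n - 1) P'(s) is the sum, over p and
    over the triples (i, j, k), of s^(W(p') - 1), where p' is p after the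
    exchange.  Every p has lam n + O(lam d) triples, and W(p') = W(p) + 1
    unless one of boundedly many coincidences of probability O(d^2/n) occurs,
    which leads to e = O(d^4/n).  Finally d^4 = O(exp lam). *)

Definition bad (d a b x y : nat) : bool :=
  [&& a < b, x != y & absdiff a b + absdiff x y <= d.+1].

Definition badpairs d n (p : 'S_n) : {set 'I_n * 'I_n} :=
  [set u : 'I_n * 'I_n | bad d u.1 u.2 (p u.1) (p u.2)].

Definition nbad d n (p : 'S_n) : nat := #|badpairs d p|.

Lemma perm_val_inj n (p : 'S_n) (a b : 'I_n) : (p a = p b :> nat) -> a = b.
Proof. by move/val_inj/perm_inj. Qed.

Lemma leq_bigmin (I : finType) (P : pred I) (F : I -> nat) c k :
  (k <= \big[minn/c]_(i | P i) F i) = (k <= c) && [forall (i | P i), k <= F i].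
Proof.
have -> : [forall (i | P i), k <= F i] =
    all (fun i => P i ==> (k <= F i)) (index_enum I).
  apply/forallP/allP => [h i _|h i]; first exact: h.
  exact/h/mem_index_enum.
elim: (index_enum I) => [|i r IH]; first by rewrite big_nil andbT.
by rewrite big_cons /=; case: (P i); rewrite //= leq_min IH andbCA.
Qed.

(** The hypothesis ensures that the neutral element [2 * n] of the minimum does not fall below the
    threshold d + 2. *)
Lemma min_manhattan_geE d n (p : 'S_n) : d.+2 <= 2 * n ->
  (d + 2 <= min_manhattan p) = (nbad d p == 0).
Proof.
move=> dn; rewrite /min_manhattan addn2 leq_bigmin dn cards_eq0 /=.
apply/forallP/eqP => [h|h i].
  apply/setP => -[i j]; rewrite !inE /= /bad; apply/negbTE/negP => /and3P[ij _].
  move: (h i); rewrite leq_bigmin => /andP[_ /forall_inP /(_ j ij)].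
  by rewrite ltnNge => /negbTE; rewrite /mdist => ->.
rewrite leq_bigmin dn /=; apply/forall_inP => j ij.
rewrite ltnNge; apply/negP => le; move/setP/(_ (i, j)): h.
rewrite !inE /= /bad ij; rewrite /mdist in le; rewrite le andbT.
case: eqP => // /perm_val_inj eij; by rewrite eij ltnn in ij.
Qed.

(** * Counting bad offsets *)

(** The two differences count the y to the left and to the right of x, in intervals cut off at m.
    Since x may exceed m, induction on m applies. *)
Lemma sum_close_neq m x r :
  \sum_(y < m) (((x : nat) != y) && (absdiff x y <= r) : nat)
  = (minn m x - minn m (x - r)) + (minn m (x + r).+1 - minn m x.+1).
Proof.
elim: m => [|m IH]; first by rewrite big_ord0; lia.
rewrite big_ord_recr /= IH /absdiff.
case: (leqP (x - m + (m - x)) r) => h; case: eqP => e /=; lia.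
Qed.

Lemma card_close_le n D x : #|[set y : 'I_n | absdiff y x <= D]| <= (2 * D).+1.
Proof.
rewrite -sum1_card big_mkcond /=.
apply: (@leq_trans (\sum_(y < n) ((y == x :> nat) + ((x != y :> nat) && (absdiff x y <= D))))).
  apply: leq_sum => y _; rewrite inE eq_sym /absdiff; case: ifP => // h.
  case: eqP => //= _; lia.
rewrite big_split /= sum_close_neq.
rewrite -[(2 * D).+1]add1n; apply: leq_add; last by lia.
suff -> : \sum_(y < n) (y == x :> nat) = (x < n) by case: (x < n).
elim: n => [|m IH]; first by rewrite big_ord0.
rewrite big_ord_recr /= IH; case: eqP => /=; lia.
Qed.

(** Here r is the distance left for the values once j - i is spent. As i < j gives r <= d, an x at
    distance at least d from both borders has r admissible values on each side. *)
Lemma sum_bad_row d n (i j x : nat) : x < n -> i < j ->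
  let r := d.+1 - (j - i) in
  let S := \sum_(y < n) (bad d i j x y : nat) in
  S <= 2 * r /\ (d <= x -> x + d < n -> S = 2 * r).
Proof.
move=> xn ij r.
have -> : \sum_(y < n) (bad d i j x y : nat) =
   \sum_(y < n) (((x : nat) != y) && (absdiff x y <= r) : nat).
  apply: eq_bigr => y _; rewrite /bad ij /= /absdiff /r.
  by case: eqP => //= e; congr nat_of_bool; lia.
rewrite sum_close_neq /r; split; lia.
Qed.

(** With t = j - i and L = m - 1 - i, the sum of 2 (d + 1 - t) over all t >= 1 is d (d + 1). The
    subtracted product is the tail t > L, the same sum for d - L. *)
Lemma sum_rows d i m :
  \sum_(j < m | i < j) 2 * (d.+1 - (j - i)) =
  d * d.+1 - (d - (m.-1 - i)) * (d.+1 - (m.-1 - i)).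
Proof.
rewrite big_mkcond /=.
elim: m => [|m IH]; first by rewrite big_ord0 /=; rewrite ?sub0n !subn0 subnn.
rewrite big_ord_recr /= IH; case: ltnP => h; last first.
  by rewrite addn0; (have -> : m.-1 - i = m - i by lia).
have -> : m.-1 - i = (m - i).-1 by lia.
have: 0 < m - i by lia.
move: (m - i) => [//|t] _ /=.
case: (leqP t d) => td; last by nia.
have [u ->] : exists u, d = t + u by exists (d - t); lia.
have -> : t + u - t = u by lia.
have -> : (t + u).+1 - t = u.+1 by lia.
have -> : (t + u) - t.+1 = u.-1 by lia.
have -> : (t + u).+1 - t.+1 = u by lia.
have: u.-1 * u <= u * u.+1 by nia.
have: u * u.+1 <= (t + u) * (t + u).+1 by nia.
case: u {td} => [|u] /=; nia.
Qed.

(** The full count d (d + 1) is lam; each border that is too close costs at most lam. Only the right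
    border matters for i, since [bad] requires i < j. *)
Lemma sum_bad d n (i x : 'I_n) :
  let S := \sum_(j < n) \sum_(y < n) (bad d i j x y : nat) in
  S <= d * d.+1 /\
  d * d.+1 <= S + d * d.+1 * ((n <= i + d) + (x < d) + (n <= x + d)).
Proof.
have -> : \sum_(j < n) \sum_(y < n) (bad d i j x y : nat) =
  \sum_(j < n | i < j) \sum_(y < n) (bad d i j x y : nat).
  rewrite [RHS]big_mkcond; apply: eq_bigr => j _; case: ifP => // h.
  by rewrite big1 // => y _; rewrite /bad h.
move=> S; split.
  apply: (@leq_trans (\sum_(j < n | i < j) 2 * (d.+1 - (j - i)))).
    by apply: leq_sum => j ij; case: (@sum_bad_row d n i j x).
  by rewrite sum_rows leq_subr.
case: (leqP n (i + d)) => h1; first by rewrite /=; nia.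
case: (ltnP x d) => h2; first by rewrite /=; nia.
case: (leqP n (x + d)) => h3; first by rewrite /=; nia.
suff -> : S = d * d.+1 by lia.
rewrite /S (eq_bigr (fun j : 'I_n => 2 * (d.+1 - (j - i)))).
  rewrite sum_rows; have -> : d - (n.-1 - i) = 0 by lia.
  by rewrite mul0n subn0.
by move=> j ij; case: (@sum_bad_row d n i j x (ltn_ord x) ij) => _ ->.
Qed.

Definition triples d n (p : 'S_n) : nat :=
  \sum_(i < n) \sum_(j < n) \sum_(k < n) (bad d i j (p i) (p k) : nat).

Lemma sum_lt_le n c : \sum_(x < n) (x < c : nat) <= c.
Proof.
suff -> : \sum_(x < n) (x < c : nat) = minn n c by lia.
elim: n => [|n IH]; first by rewrite big_ord0; lia.
rewrite big_ord_recr /= IH; lia.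
Qed.

Lemma sum_ge_le n c : \sum_(x < n) (n <= x + c : nat) <= c.
Proof.
suff H m : \sum_(x < m) (n <= x + c : nat) = m - (n - c) by rewrite H; lia.
elim: m => [|m IH]; first by rewrite big_ord0.
rewrite big_ord_recr /= IH; lia.
Qed.

(** As p is a bijection, summing over k amounts to summing over the value [p k], and each of the
    three border conditions of [sum_bad] holds for at most d positions i. *)
Lemma triples_bounds d n (p : 'S_n) :
  triples d p <= n * (d * d.+1) /\
  n * (d * d.+1) <= triples d p + d * d.+1 * (3 * d).
Proof.
have -> : triples d p =
    \sum_(i < n) \sum_(j < n) \sum_(y < n) (bad d i j (p i) y : nat).
  apply: eq_bigr => i _; apply: eq_bigr => j _.
  by rewrite [RHS](reindex_inj (@perm_inj _ p)).
have <- : \sum_(i < n) d * d.+1 = n * (d * d.+1) by rewrite sum_nat_const card_ord.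
split.
  apply: leq_sum => i _.
  by case: (sum_bad d i (p i)).
apply: (@leq_trans (\sum_(i < n) (\sum_(j < n) \sum_(y < n) (bad d i j (p i) y : nat)
   + d * d.+1 * ((n <= i + d) + (p i < d) + (n <= p i + d))))).
  by apply: leq_sum => i _; case: (sum_bad d i (p i)).
rewrite big_split /= leq_add2l -big_distrr /= leq_mul2l; apply/orP; right.
rewrite !big_split /=.
have h1 := sum_ge_le n d.
have h2 := sum_lt_le n d; rewrite (reindex_inj (@perm_inj _ p)) /= in h2.
have h3 := h1; rewrite (reindex_inj (@perm_inj _ p)) /= in h3.
have -> : 3 * d = d + d + d by lia.
by rewrite !leq_add.
Qed.

(** * Probabilities of close values *)

(* Averaging over the positions [m'] outside [S] that can play the role of [m]. *)
Lemma card_constraint_le n (S : {set 'I_n}) (m : 'I_n) (A : pred 'S_n)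
    (V : 'S_n -> {set 'I_n}) (M : nat) :
  m \notin S ->
  (forall m' p, m' \notin S -> A (tperm m m' * p)%g = A p) ->
  (forall m' p, m' \notin S -> V (tperm m m' * p)%g = V p) ->
  (forall p, #|V p| <= M) ->
  (n - #|S|) * \sum_(p : 'S_n) (A p && (p m \in V p) : nat)
    <= M * \sum_(p : 'S_n) (A p : nat).
Proof.
move=> mS invA invV cardV.
have cS : #|~: S| = n - #|S| by rewrite cardsCs setCK card_ord.
rewrite -cS -sum_nat_const big_distrr /=.
have step m' : m' \in ~: S ->
    \sum_(p : 'S_n) (A p && (p m \in V p) : nat)
    = \sum_(p : 'S_n) (A p && (p m' \in V p) : nat).
  rewrite inE => m'S.
  rewrite (reindex_inj (mulgI (tperm m m'))) /=; apply: eq_bigr => p _.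
  by rewrite invA // invV // permM tpermL.
(* For a fixed p, injectivity leaves at most [#|V p|] positions m' with [p m'] in [V p]. *)
rewrite (eq_bigr _ step) exchange_big /=; apply: leq_sum => p _.
case: (A p) => /=; last by rewrite big1.
rewrite muln1; apply: leq_trans (cardV p).
rewrite -(card_preimset (V p) (@perm_inj _ p)) -[X in _ <= X]sum1_card.
rewrite [X in X <= _]big_mkcond [X in _ <= X]big_mkcond /=; apply: leq_sum => i _.
by rewrite !inE; case: (_ \notin _); case: (_ \in _).
Qed.

Lemma card_close_value n (m q : 'I_n) D : m != q ->
  n.-1 * \sum_(p : 'S_n) (absdiff (p m) (p q) <= D : nat) <= (2 * D).+1 * n`!.
Proof.
move=> mq.
have := @card_constraint_le n [set q] m xpredT
  (fun p => [set y : 'I_n | absdiff y (p q) <= D]) (2 * D).+1.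
rewrite cards1 subn1 sum1_card card_Sn; under eq_bigr do rewrite inE.
apply=> //; first by rewrite inE.
  move=> m' p; rewrite inE => m'q; apply/setP => y; rewrite !inE permM tpermD //.
by move=> p; apply: card_close_le.
Qed.

(** The two events are peeled off in turn. Moving m outside {i, j, k} does not affect the values at
    i, j, k, which gives the factor n - 3; the event at k is then left to [card_close_value]. *)
Lemma card_close_values n (i j k m q : 'I_n) d D :
  uniq [:: i; j; k] -> m \notin [:: i; j; k] -> q \in [:: i; j] ->
  n.-1 * (n - 3) *
    \sum_(p : 'S_n) ((absdiff (p k) (p i) <= d) && (absdiff (p m) (p q) <= D) : nat)
  <= (2 * d).+1 * (2 * D).+1 * n`!.
Proof.
move=> uijk mijk qij.
have ki : k != i by move: uijk; rewrite /= !inE negb_or eq_sym => /andP[/andP[_]]; rewrite eq_sym.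
have h1 := @card_close_value n k i d ki.
have h2 := @card_constraint_le n [set x in [:: i; j; k]] m
  (fun p => absdiff (p k) (p i) <= d)
  (fun p => [set y : 'I_n | absdiff y (p q) <= D]) (2 * D).+1.
have cS : #|[set x in [:: i; j; k]]| = 3 by rewrite cardsE; apply/card_uniqP.
rewrite cS in h2.
suff: (n - 3) * \sum_(p : 'S_n) ((absdiff (p k) (p i) <= d) && (absdiff (p m) (p q) <= D) : nat)
  <= (2 * D).+1 * \sum_(p : 'S_n) (absdiff (p k) (p i) <= d : nat).
  move=> h3; rewrite -mulnA; apply: (leq_trans (leq_mul (leqnn _) h3)).
  by rewrite mulnCA [X in _ <= X * _]mulnC -mulnA leq_mul2l h1 orbT.
have tD (x m' : 'I_n) (p : 'S_n) : x \in [:: i; j; k] -> m' \notin [:: i; j; k] ->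
   (tperm m m' * p)%g x = p x.
  move=> xS m'S; rewrite permM tpermD //; first by apply: contraNneq mijk => ->.
  by apply: contraNneq m'S => ->.
under eq_bigr => p _. rewrite -[absdiff (p m) _ <= _](in_set (fun y : 'I_n => absdiff y (p q) <= D)). over.
apply: h2.
- by rewrite inE.
- by move=> m' p; rewrite inE => m'S; rewrite !tD // !inE eqxx ?orbT.
- move=> m' p; rewrite inE => m'S; apply/setP => y; rewrite !inE tD //.
  by move: qij; rewrite !inE => /orP[] ->; rewrite ?orbT.
- by move=> p; apply: card_close_le.
Qed.

(** * The effect of one exchange of values *)

(* Coincidences that may prevent the exchange of the values at [j] and [k]
   from creating exactly one bad pair: a position near [i] or [j] whose value
   is near the value at [i] or [j], or, for [far_hits], a position near [k]
   with such a value. *)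
Definition near_hits d n (p : 'S_n) (i j : 'I_n) : nat :=
  \sum_(q in [set i; j]) \sum_(r in [set i; j])
    \sum_(m : 'I_n | (m != q) && (absdiff m r <= d))
      (absdiff (p m) (p q) <= 2 * d).

Definition far_hits d n (p : 'S_n) (i j k : 'I_n) : nat :=
  \sum_(q in [set i; j])
    \sum_(m : 'I_n | (m \notin [:: i; j; k]) && (absdiff m k <= d))
      (absdiff (p m) (p q) <= 2 * d).

Lemma near_hits_gt0 d n (p : 'S_n) (i j q r m : 'I_n) :
  q \in [set i; j] -> r \in [set i; j] -> m != q -> absdiff m r <= d ->
  absdiff (p m) (p q) <= 2 * d -> 0 < near_hits d p i j.
Proof.
move=> qij rij mq mr pmq; rewrite /near_hits.
by rewrite (bigD1 q) //= (bigD1 r) //= (bigD1 m) ?mq ?mr //= pmq.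
Qed.

Lemma far_hits_gt0 d n (p : 'S_n) (i j k q m : 'I_n) :
  q \in [set i; j] -> m \notin [:: i; j; k] -> absdiff m k <= d ->
  absdiff (p m) (p q) <= 2 * d -> 0 < far_hits d p i j k.
Proof.
move=> qij mijk mk pmq; rewrite /far_hits.
by rewrite (bigD1 q) //= (bigD1 m) ?mijk ?mk //= pmq.
Qed.

Definition close_pair d n (p : 'S_n) (u v : 'I_n) : bool :=
  (u != v) && (absdiff u v + absdiff (p u) (p v) <= d.+1).

Lemma close_pairC d n (p : 'S_n) (u v : 'I_n) : close_pair d p u v = close_pair d p v u.
Proof. rewrite /close_pair eq_sym; congr (_ && _); rewrite /absdiff; lia. Qed.

Lemma bad_perm d n (p : 'S_n) (u v : 'I_n) :
  bad d u v (p u) (p v) = (u < v) && close_pair d p u v.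
Proof.
rewrite /bad /close_pair; case: ltnP => //= uv; congr (_ && _).
by apply/negb_inj; rewrite !negbK; apply/eqP/eqP => [/perm_val_inj|->].
Qed.

Lemma close_pair_close d n (p : 'S_n) (u v : 'I_n) :
  close_pair d p u v -> [/\ u != v, absdiff u v <= d & absdiff (p u) (p v) <= d].
Proof.
rewrite /close_pair => /andP[uv le]; split => //.
  suff : p u <> p v :> nat by move: le; rewrite /absdiff; lia.
  by move/perm_val_inj => e; rewrite e eqxx in uv.
suff : u <> v :> nat by move: le; rewrite /absdiff; lia.
by move/val_inj => e; rewrite e eqxx in uv.
Qed.

(** By contraposition: without hits, neither j nor k lies in a close pair before the exchange, and
    afterwards {i, j} is the only close pair meeting {j, k}. The radius 2d in the hits comes from
    the triangle inequality, a value near [p k] being within 2d of [p i]. *)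
Lemma nbad_swap d n (p : 'S_n) (i j k : 'I_n) :
  bad d i j (p i) (p k) ->
  nbad d (tperm j k * p)%g != (nbad d p).+1 ->
  (0 < near_hits d p i j) || (k \notin [:: i; j]) && (0 < far_hits d p i j k).
Proof.
move=> bijk; apply: contraR; rewrite negb_or => /andP[nA nB].
have [ij pik dij dpik] : [/\ i < j, p i != p k :> nat, absdiff i j <= d & absdiff (p k) (p i) <= d].
  move: bijk; rewrite /bad => /and3P[lij pik]; rewrite /absdiff => le; split=> //; lia.
have ki : k != i by apply: contraNneq pik => ->.
have ji : j != i by apply: contraTneq ij => ->; rewrite ltnn.
have iS : i \in [set i; j] by rewrite !inE eqxx.
have jS : j \in [set i; j] by rewrite !inE eqxx orbT.
have A q r m : q \in [set i; j] -> r \in [set i; j] -> m != q -> absdiff m r <= d ->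
    absdiff (p m) (p q) <= 2 * d -> False.
  by move=> *; move/negP: nA; apply; apply: (@near_hits_gt0 _ _ _ _ _ q r m).
have dd : d <= 2 * d by lia.
have a1 v : close_pair d p v j -> False.
  by case/close_pair_close => vj d1 d2; apply: (A j j v) => //; apply: leq_trans d2 _.
(* If k = j, then j itself is a near hit, its value being close to that of i. *)
have kj : k != j.
  apply/negP => /eqP ekj; apply: (A i j j) => //; first by rewrite /absdiff; lia.
  by rewrite -{1}ekj; apply: leq_trans dpik _.
have B q m : q \in [set i; j] -> m != i -> m != j -> m != k -> absdiff m k <= d ->
    absdiff (p m) (p q) <= 2 * d -> False.
  move=> qS mi mj mk d1 d2; move/negP: nB; apply.
  rewrite !inE negb_or ki kj /=; apply: (@far_hits_gt0 _ _ _ _ _ _ q m) => //.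
  by rewrite !inE !negb_or mi mj mk.
have b1 v : close_pair d p v k -> False.
  case: (eqVneq v j) => [->|vj]; first by rewrite close_pairC => /a1.
  case/close_pair_close => vk d1 d2; case: (eqVneq v i) => [evi|vi].
    apply: (A i i k) => //; last exact: leq_trans dpik _.
    by rewrite evi in d1; move: d1; rewrite /absdiff; lia.
  by apply: (B i v) => //; move: d2 dpik; rewrite /absdiff; lia.
set p' := (tperm j k * p)%g.
have p'j : p' j = p k by rewrite permM tpermL.
have p'k : p' k = p j by rewrite permM tpermR.
have p'D x : x != j -> x != k -> p' x = p x.
  by move=> xj xk; rewrite permM tpermD // eq_sym.
have c1 v : v != i -> close_pair d p' v j -> False.
  move=> vi /close_pair_close[vj d1]; rewrite p'j.
  case: (eqVneq v k) => [evk _|vk].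
    by apply: (A i j k); rewrite -?evk // ?evk //; apply: leq_trans dpik _.
  rewrite p'D // => d2; apply: (A i j v) => //.
  by move: d2 dpik; rewrite /absdiff; lia.
have d1 v : close_pair d p' v k -> False.
  case: (eqVneq v j) => [->|vj]; first by rewrite close_pairC; apply: c1.
  move=> /close_pair_close[vk d1]; rewrite p'k p'D // => d2.
  case: (eqVneq v i) => [evi|vi].
    apply: (A i i k) => //; last exact: leq_trans dpik _.
    by rewrite evi in d1; move: d1; rewrite /absdiff; lia.
  by apply: (B j v) => //; apply: leq_trans d2 _.
have sij : close_pair d p' i j.
  move: bijk; rewrite /bad /close_pair p'j p'D 1?eq_sym // ?[i == k]eq_sym //.
  by move=> /and3P[_ _ ->]; rewrite ?andbT eq_sym.
have nij : (i, j) \notin badpairs d p.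
  by rewrite inE /= bad_perm; apply/negP => /andP[_ /a1].
apply/eqP; rewrite /nbad.
suff -> : badpairs d p' = (i, j) |: badpairs d p by rewrite cardsU1 nij.
(* Pairs meeting k come first, then pairs meeting j; the values of all other pairs are unchanged. *)
apply/setP => -[u v]; rewrite !inE /= !bad_perm xpair_eqE.
case: (eqVneq v k) => [->|vk].
  rewrite [k == j](negbTE kj) andbF /=; congr (_ && _).
  by apply/idP/idP => [/d1|/b1].
case: (eqVneq u k) => [->|uk].
  rewrite [k == i](negbTE ki) /=; congr (_ && _).
  by rewrite (close_pairC _ p') (close_pairC _ p); apply/idP/idP => [/d1|/b1].
case: (eqVneq v j) => [->|vj].
  case: (eqVneq u i) => [->|ui] /=; first by rewrite ij sij.
  by congr (_ && _); apply/idP/idP => [/(c1 _ ui)|/a1].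
rewrite andbF /=; case: (eqVneq u j) => [->|uj].
  case: (eqVneq v i) => [->|vi].
    by rewrite ltnNge (ltnW ij).
  by congr (_ && _); rewrite (close_pairC _ p') (close_pairC _ p); apply/idP/idP => [/(c1 _ vi)|/a1].
by rewrite /close_pair !p'D.
Qed.

(** * The number of exceptional triples *)

Lemma leq_sum_const (I : finType) (P : pred I) (F : I -> nat) N c :
  #|P| <= N -> (forall i, P i -> F i <= c) -> \sum_(i | P i) F i <= N * c.
Proof.
move=> PN Fc; apply: (@leq_trans (#|P| * c)); last by rewrite leq_mul2r PN orbT.
by rewrite -sum_nat_const; apply: leq_sum.
Qed.

Lemma card_close_pred_le n D (x : nat) (Q : pred 'I_n) :
  #|[pred y : 'I_n | Q y && (absdiff y x <= D)]| <= (2 * D).+1.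
Proof.
apply: leq_trans (card_close_le n D x); apply/subset_leq_card/subsetP => y.
by rewrite !inE => /andP[].
Qed.

Lemma card_pair_le (T : finType) (i j : T) : #|[pred q in [set i; j]]| <= 2.
Proof. by rewrite cards2; case: (_ != _). Qed.

Lemma sum_near_hits d n (i j : 'I_n) :
  n.-1 * \sum_(p : 'S_n) near_hits d p i j
    <= 4 * ((2 * d).+1 * ((2 * (2 * d)).+1 * n`!)).
Proof.
rewrite /near_hits exchange_big big_distrr /= -[4]/(2 * 2) -!mulnA.
apply: leq_sum_const => [|q qS]; first exact: card_pair_le.
rewrite exchange_big big_distrr /=.
apply: leq_sum_const => [|r rS]; first exact: card_pair_le.
rewrite exchange_big big_distrr /=.
apply: leq_sum_const => [|m /andP[mq _]]; first exact: card_close_pred_le.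
exact: card_close_value.
Qed.

(** Since k ranges over up to n positions, one closeness event would not give a bound of order 1/n;
    the closeness of [p k] and [p i] is kept as a second event. *)
Lemma sum_far_hits d n (i j : 'I_n) : i != j ->
  n.-1 * (n - 3) * \sum_(p : 'S_n) \sum_(k | k \notin [:: i; j])
     (absdiff (p k) (p i) <= d) * far_hits d p i j k
    <= n * (2 * ((2 * d).+1 * ((2 * d).+1 * (2 * (2 * d)).+1 * n`!))).
Proof.
move=> ij; rewrite exchange_big big_distrr /=.
apply: leq_sum_const => [|k kij].
  by apply: leq_trans (max_card _) _; rewrite card_ord.
have -> : \sum_(p : 'S_n) (absdiff (p k) (p i) <= d) * far_hits d p i j k =
  \sum_(p : 'S_n) \sum_(q in [set i; j])
    \sum_(m : 'I_n | (m \notin [:: i; j; k]) && (absdiff m k <= d))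
      ((absdiff (p k) (p i) <= d) && (absdiff (p m) (p q) <= 2 * d)).
  apply: eq_bigr => p _; rewrite /far_hits big_distrr; apply: eq_bigr => q _.
  by rewrite big_distrr; apply: eq_bigr => m _; rewrite /= mulnb.
rewrite exchange_big big_distrr /=.
apply: leq_sum_const => [|q qS]; first exact: card_pair_le.
rewrite exchange_big big_distrr /=.
apply: leq_sum_const => [|m /andP[mS _]]; first exact: card_close_pred_le.
apply: (@card_close_values n i j k) => //.
  move: kij; rewrite /= !inE !negb_or !andbT => /andP[ki kj].
  by rewrite ij eq_sym ki eq_sym kj.
by move: qS; rewrite !inE.
Qed.

Definition exceptions d n : nat :=
  \sum_(p : 'S_n) \sum_(i < n) \sum_(j < n) \sum_(k < n)
    (bad d i j (p i) (p k) && (nbad d (tperm j k * p)%g != (nbad d p).+1)).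

(** There are n choices of i and at most 2d + 1 of j. The 6 is 4 + 2: four pairs (q, r) in
    [near_hits] and two q in [far_hits]. *)
Lemma exceptions_le d n :
  n.-1 * (n - 3) * exceptions d n
    <= 6 * n ^ 2 * (2 * d).+1 ^ 3 * (2 * (2 * d)).+1 * n`!.
Proof.
rewrite /exceptions exchange_big /= big_distrr /=.
have -> : 6 * n ^ 2 * (2 * d).+1 ^ 3 * (2 * (2 * d)).+1 * n`! =
  n * ((2 * d).+1 * (6 * n * (2 * d).+1 ^ 2 * (2 * (2 * d)).+1 * n`!)).
  by move: (2 * d).+1 (2 * (2 * d)).+1 => a b; rewrite -!mulnn !expnS; nia.
apply: leq_sum_const => [|i _]; first by rewrite card_ord.
rewrite exchange_big big_distrr /=.
rewrite (bigID (fun j : 'I_n => (j != i) && (absdiff j i <= d))) /=.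
rewrite [X in _ + X]big1 ?addn0; last first.
  move=> j nji; rewrite big1 ?muln0 // => p _; rewrite big1 // => k _.
  rewrite /bad; case: eqP => [|pik]; rewrite ?andbF //=.
  case: ltnP => //= ij; case: leqP => //= le; exfalso; move/negP: nji; apply.
  apply/andP; split; first by apply: contraTneq ij => ->; rewrite ltnn.
  by move: le pik; rewrite /absdiff; lia.
apply: leq_sum_const => [|j /andP[ji _]]; first exact: card_close_pred_le.
(* Near hits do not depend on k, so they are multiplied by the number of k whose value is close to
   [p i], at most 2d + 1. *)
apply: (@leq_trans (n.-1 * (n - 3) * \sum_(p : 'S_n)
    ((2 * d).+1 * near_hits d p i j + \sum_(k | k \notin [:: i; j])
      (absdiff (p k) (p i) <= d) * far_hits d p i j k))).
  rewrite leq_mul2l; apply/orP; right; apply: leq_sum => p _.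
  apply: (@leq_trans (\sum_(k < n) (((absdiff (p k) (p i) <= d) * near_hits d p i j) +
     (if k \notin [:: i; j] then (absdiff (p k) (p i) <= d) * far_hits d p i j k else 0)))).
    apply: leq_sum => k _; case b: (bad _ _ _ _ _) => //=.
    case c: (_ != _) => //=; have := nbad_swap b c.
    have -> : absdiff (p k) (p i) <= d.
      by move: b; rewrite /bad => /and3P[]; rewrite /absdiff; lia.
    rewrite !mul1n; case: (k \notin _) => /=; lia.
  rewrite big_split /= -[X in _ + X]big_mkcond leq_add2r -big_distrl /=.
  rewrite leq_mul2r; apply/orP; right.
  have <- : \sum_(y < n) (absdiff y (p i) <= d : nat) =
      \sum_(k < n) (absdiff (p k) (p i) <= d : nat).
    by rewrite (reindex_inj (@perm_inj _ p)).
  by rewrite -big_mkcond sum1_card; apply: (@card_close_pred_le n d (p i) xpredT).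
have := sum_far_hits d (i := i) (j := j); rewrite eq_sym ji => /(_ isT).
have := sum_near_hits d i j; rewrite big_split /= -big_distrr /=.
move: (\sum_(p : 'S_n) near_hits d p i j) => SA.
move: (\sum_(p : 'S_n) \sum_(k | _) _) => SB.
move: (2 * d).+1 (2 * (2 * d)).+1 n`! => a b f hA hB.
rewrite mulnDr.
have hA' : n.-1 * (n - 3) * (a * SA) <= n * (4 * (a * (a * (b * f)))).
  apply: (@leq_trans ((n - 3) * a * (4 * (a * (b * f))))).
    have -> : n.-1 * (n - 3) * (a * SA) = (n - 3) * a * (n.-1 * SA).
      by move: n.-1 (n - 3) => u v; lia.
    by rewrite leq_mul2l hA orbT.
  have -> : n * (4 * (a * (a * (b * f)))) = n * a * (4 * (a * (b * f))) by lia.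
  by rewrite leq_mul2r leq_mul2r leq_subr !orbT.
apply: (leq_trans (leq_add hA' hB)).
rewrite -mulnn; lia.
Qed.

Import Order.TTheory GRing.Theory Num.Theory.
Delimit Scope R_scope with coqR.

(** * The exchange identity and its defect *)

Section SteinIdentity.
Local Open Scope ring_scope.

(** For fixed i, j, k, composing with [tperm j k] is a bijection that brings the value at k to j. On
    the right, each bad pair (i, j) is then counted once for each of the n - 1 positions k other
    than i, with k = j included. *)
Lemma sum_swap (V : zmodType) d n (F : 'S_n -> V) :
  \sum_(p : 'S_n) \sum_(i < n) \sum_(j < n) \sum_(k < n)
     F (tperm j k * p)%g *+ bad d i j (p i) (p k)
  = \sum_(p : 'S_n) F p *+ (nbad d p * n.-1).
Proof.
have -> : \sum_(p : 'S_n) F p *+ (nbad d p * n.-1) =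
  \sum_(p : 'S_n) \sum_(i < n) \sum_(j < n) \sum_(k < n | k != i)
     F p *+ bad d i j (p i) (p j).
  apply: eq_bigr => p _; rewrite mulrnA /nbad -sum1_card [in LHS]big_mkcond /=.
  rewrite pair_big /= -sumrMnr -sumrMnl; apply: eq_bigr => -[i j] _ /=.
  rewrite sumr_const cardC1 card_ord inE /=; by case: bad; rewrite ?mulr1n ?mulr0n.
rewrite exchange_big [RHS]exchange_big /=; apply: eq_bigr => i _.
rewrite exchange_big [RHS]exchange_big /=; apply: eq_bigr => j _.
rewrite exchange_big [RHS]exchange_big /= [RHS]big_mkcond /=; apply: eq_bigr => k _.
case: (eqVneq k i) => [->|ki] /=.
  by rewrite big1 // => p _; rewrite /bad eqxx andbF.
case: (eqVneq i j) => [->|ij].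
  by rewrite !big1 // => p _; rewrite /bad ltnn.
rewrite (reindex_inj (mulgI (tperm j k))) /=; apply: eq_bigr => p _.
by rewrite mulgA tperm2 mul1g !permM tpermR tpermD // eq_sym.
Qed.

(** Used with a and b the numbers of bad pairs before and after an exchange: the powers agree if b =
    a + 1, and otherwise both lie in [0, 1]. *)
Lemma pow_diff_le (R : realFieldType) (s : R) (a b : nat) : 0 <= s <= 1 ->
  `|s ^+ a - s ^+ b.-1| <= ((b != a.+1)%N)%:R.
Proof.
move=> /andP[s0 s1]; case: eqP => [->|_] /=; first by rewrite subrr normr0.
have [a0 b0] := (exprn_ge0 a s0, exprn_ge0 b.-1 s0).
have [a1 b1] := (exprn_ile1 a s0 s1, exprn_ile1 b.-1 s0 s1).
by rewrite ler_norml lerNl opprB !lerBlDr !ler_wpDr.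
Qed.

(** This bounds (n - 1) (lam P - P'). The first term comes from the deviation of [triples] from lam
    (n - 1), where passing from n to n - 1 costs at most one more lam; the second comes from the
    exceptional triples. *)
Lemma stein_defect_le (R : realFieldType) d n (s : R) : (0 < n)%N -> 0 <= s <= 1 ->
  `|(d * d.+1 * n.-1)%:R * (\sum_(p : 'S_n) s ^+ nbad d p)
     - n.-1%:R * \sum_(p : 'S_n) (nbad d p)%:R * s ^+ (nbad d p).-1|
  <= (d * d.+1 * (3 * d).+1 * n`! + exceptions d n)%:R.
Proof.
move=> n0 s01.
have -> : n.-1%:R * \sum_(p : 'S_n) (nbad d p)%:R * s ^+ (nbad d p).-1 =
   \sum_(p : 'S_n) s ^+ (nbad d p).-1 *+ (nbad d p * n.-1).
  rewrite big_distrr /=; apply: eq_bigr => p _.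
  by rewrite -[RHS]mulr_natl natrM mulrA (mulrC n.-1%:R).
rewrite -(sum_swap d (fun p => s ^+ (nbad d p).-1)) big_distrr /= -sumrB.
rewrite natrD /exceptions natr_sum.
have -> : (d * d.+1 * (3 * d).+1 * n`!)%:R = \sum_(p : 'S_n) (d * d.+1 * (3 * d).+1)%:R :> R.
  by rewrite sumr_const card_Sn -[RHS]mulr_natr natrM.
rewrite -big_split /=; apply: le_trans (ler_norm_sum _ _ _) _; apply: ler_sum => p _.
set G := s ^+ nbad d p.
(* Add and subtract [G] once for every triple of p. *)
have -> : (d * d.+1 * n.-1)%:R * G - \sum_(i < n) \sum_(j < n) \sum_(k < n)
     s ^+ (nbad d (tperm j k * p)%g).-1 *+ bad d i j (p i) (p k) =
  ((d * d.+1 * n.-1)%:R - (triples d p)%:R) * G + \sum_(i < n) \sum_(j < n) \sum_(k < n)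
     (G - s ^+ (nbad d (tperm j k * p)%g).-1) *+ bad d i j (p i) (p k).
  rewrite mulrBl -addrA; congr (_ + _).
  rewrite addrC /triples natr_sum mulr_suml -sumrB -sumrN; apply: eq_bigr => i _.
  rewrite natr_sum mulr_suml -sumrB -sumrN; apply: eq_bigr => j _.
  rewrite natr_sum mulr_suml -sumrB -sumrN; apply: eq_bigr => k _.
  by rewrite mulrnBl mulr_natl addrAC subrr add0r.
have G01 : 0 <= G <= 1 by case/andP: s01 => *; rewrite exprn_ge0 ?exprn_ile1.
apply: le_trans (ler_normD _ _) _; apply: lerD.
  have := triples_bounds d p; set t := triples _ _; set L := (d * d.+1)%N.
  move=> [t1 t2]; rewrite normrM (ger0_norm (proj1 (andP G01))).
  rewrite -[X in _ <= X]mulr1; apply: ler_pM => //; [by case/andP: G01| |by case/andP: G01].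
  rewrite ler_norml lerBlDr lerBrDr addrC lerBlDr -!natrD !ler_nat.
  have -> : n = n.-1.+1 by rewrite prednK.
  by apply/andP; split; nia.
rewrite natr_sum; apply: le_trans (ler_norm_sum _ _ _) _; apply: ler_sum => i _.
rewrite natr_sum; apply: le_trans (ler_norm_sum _ _ _) _; apply: ler_sum => j _.
rewrite natr_sum; apply: le_trans (ler_norm_sum _ _ _) _; apply: ler_sum => k _.
by case: bad; rewrite ?mulr0n ?normr0 //= mulr1n; apply: pow_diff_le.
Qed.

End SteinIdentity.

(** * From the differential inequality to the number of zeros *)

Lemma derivable_pt_lim_bigsum (I : Type) (r : seq I) (f f' : I -> R -> R) (x : R) :
  (forall i, derivable_pt_lim (f i) x (f' i x)) ->
  derivable_pt_lim (fun y => \sum_(i <- r) f i y)%R x (\sum_(i <- r) f' i x)%R.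
Proof.
move=> df; elim: r => [|i r IH].
  rewrite big_nil; apply: (derivable_pt_lim_ext (fun=> 0%R)); last exact: derivable_pt_lim_const.
  by move=> y; rewrite big_nil.
rewrite big_cons.
apply: (derivable_pt_lim_ext (f i + (fun y => \sum_(i <- r) f i y)%R)%F).
  by move=> y; rewrite big_cons.
exact: derivable_pt_lim_plus.
Qed.

(* With [P s = \sum_i s ^ w i], the hypothesis bounds [P' - lam P], hence the
   derivative of [exp (- lam s) * P s], whose values at 0 and 1 are compared. *)
Lemma poisson_zero_count (I : finType) (w : I -> nat) (lam e : R) :
  (0 <= lam)%coqR ->
  (forall s : R, (0 <= s <= 1)%coqR ->
     (Rabs (lam * (\sum_i pow s (w i))%R - (\sum_i INR (w i) * pow s (w i).-1)%R) <= e)%coqR) ->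
  (Rabs (INR #|[set i | w i == 0%N]| - exp (- lam) * INR #|I|) <= e)%coqR.
Proof.
move=> lam0 he.
pose P s : R := (\sum_i pow s (w i))%R.
pose P' s : R := (\sum_i (INR (w i) * pow s (w i).-1))%R.
(* Since 0 ^ 0 = 1, exactly the i with [w i = 0] contribute. *)
have P0 : P 0%coqR = INR #|[set i | w i == 0%N]|.
  rewrite /P -sum1_card INRE natr_sum [RHS]big_mkcond /=; apply: eq_bigr => i _.
  by rewrite inE; case: (w i) => [|m] //=; rewrite Rmult_0_l.
have P1 : P 1%coqR = INR #|I|.
  rewrite /P INRE -sum1_card natr_sum; apply: eq_bigr => i _.
  by rewrite pow1.
have dP s : derivable_pt_lim P s (P' s).
  apply: (@derivable_pt_lim_bigsum I (index_enum I) (fun i x => pow x (w i))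
    (fun i x => INR (w i) * pow x (w i).-1)%coqR) => i.
  exact: derivable_pt_lim_pow.
have dh s : derivable_pt_lim (fun x => exp (- lam * x) * P x)%coqR s
    (exp (- lam * s) * (P' s - lam * P s))%coqR.
  have dl : derivable_pt_lim (fun x => - lam * x)%coqR s (- lam * 1)%coqR.
    exact/derivable_pt_lim_scal/derivable_pt_lim_id.
  have de := derivable_pt_lim_comp _ _ _ _ _ dl (derivable_pt_lim_exp (- lam * s)%coqR).
  have := derivable_pt_lim_mult _ _ _ _ _ de (dP s).
  rewrite /comp.
  have -> : (exp (- lam * s) * (- lam * 1) * P s + exp (- lam * s) * P' s =
     exp (- lam * s) * (P' s - lam * P s))%coqR by ring.
  by [].
have [c [hc [c0 c1]]] := MVT_cor2 _ _ 0%coqR 1%coqR Rlt_0_1 (fun c _ => dh c).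
move: hc; rewrite P0 P1 Rmult_0_r exp_0 !Rmult_1_r Rmult_1_l Rminus_0_r Rmult_1_r => hc.
rewrite Rabs_minus_sym hc Rabs_mult Rabs_minus_sym Rabs_right; last by apply/Rle_ge/Rlt_le/exp_pos.
have h := he c (conj (Rlt_le _ _ c0) (Rlt_le _ _ c1)).
apply: Rle_trans h.
rewrite -[X in Rle _ X]Rmult_1_l; apply: Rmult_le_compat_r; first exact: Rabs_pos.
(* The factor exp (- lam c) is at most 1, with equality when lam = 0, hence the separate case. *)
rewrite -exp_0; case: (Req_dec (- lam * c) 0)%coqR => [->|ne]; first exact: Rle_refl.
apply/Rlt_le/exp_increasing; nra.
Qed.

(** * Explicit constants and the final estimate *)

(** The constants: (2d + 1)^3 (4d + 1) <= 135 d^4, 6 n^2 <= 24 (n - 1) (n - 3) for n >= 6, and 3248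
    = 8 + 24 * 135. The outer 2 comes from n <= 2 (n - 1). *)
Lemma error_bound d n : (0 < d)%N -> (6 <= n)%N ->
  (n * (d * d.+1 * (3 * d).+1 * n`! + exceptions d n) <= 2 * (3248 * d ^ 4 * n`! * n.-1))%N.
Proof.
move=> d0 n6.
set F := n`!; set Q := ((2 * d).+1 ^ 3 * (2 * (2 * d)).+1)%N.
have Q4 : (Q <= 135 * d ^ 4)%N.
  have -> : (135 * d ^ 4 = (3 * d) ^ 3 * (5 * d))%N by rewrite !expnS !expn0; lia.
  by apply: leq_mul; [rewrite leq_exp2r; lia | lia].
have X : (exceptions d n <= 24 * Q * F)%N.
  have c0 : (0 < n.-1 * (n - 3))%N by nia.
  rewrite -(leq_pmul2l c0); apply: leq_trans (exceptions_le d n) _.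
  have -> : (6 * n ^ 2 * (2 * d).+1 ^ 3 * (2 * (2 * d)).+1 * n`! = 6 * n ^ 2 * (Q * F))%N.
    by rewrite /Q /F -!mulnA.
  have -> : (n.-1 * (n - 3) * (24 * Q * F) = 24 * (n.-1 * (n - 3)) * (Q * F))%N.
    by move: (n.-1 * (n - 3))%N => z; lia.
  rewrite leq_mul2r; apply/orP; right; rewrite -mulnn.
  have [m ->] : exists m, n = (m + 6)%N by exists (n - 6)%N; lia.
  have -> : (m + 6).-1 = (m + 5)%N by lia.
  have -> : (m + 6 - 3 = m + 3)%N by lia.
  nia.
have L : (d * d.+1 * (3 * d).+1 <= 8 * d ^ 4)%N.
  apply: (@leq_trans (8 * d ^ 3)).
    have -> : (8 * d ^ 3 = d * (2 * d) * (4 * d))%N by rewrite !expnS expn0; lia.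
    by apply: leq_mul; [apply: leq_mul; lia | lia].
  by rewrite leq_mul2l leq_pexp2l.
have T : (d * d.+1 * (3 * d).+1 * F + exceptions d n <= 3248 * d ^ 4 * F)%N.
  have -> : (3248 * d ^ 4 * F = 8 * d ^ 4 * F + 24 * (135 * d ^ 4) * F)%N by lia.
  apply: leq_add; first by rewrite leq_mul2r L orbT.
  by apply: leq_trans X _; rewrite leq_mul2r leq_mul2l Q4 !orbT.
apply: leq_trans (leq_mul (leqnn n) T) _.
have -> : (2 * (3248 * d ^ 4 * F * n.-1) = 2 * n.-1 * (3248 * d ^ 4 * F))%N.
  by move: n.-1 (d ^ 4)%N => m z; lia.
by rewrite leq_mul2r; apply/orP; right; lia.
Qed.

Lemma prob_dist_ge_poisson d n : (0 < d)%N -> (6 <= n)%N -> (d.+2 <= 2 * n)%N ->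
  (Rabs (prob_dist_ge n (d + 2) - exp (- INR (d * d + d)))
    <= 6496 * INR (d ^ 4) / INR n)%coqR.
Proof.
move=> d0 n6 dn.
have n0 : (0 < INR n)%coqR by apply: lt_0_INR; lia.
have n1 : (0 < INR n.-1)%coqR by apply: lt_0_INR; lia.
have F0 : (0 < INR n`!)%coqR by apply: lt_0_INR; have := fact_gt0 n; lia.
have dd : (d * d.+1 = d * d + d)%N by rewrite mulnS addnC.
(* Dividing the bound of [stein_defect_le] by n - 1 bounds lam P - P' itself. *)
pose e := (INR (d * d.+1 * (3 * d).+1 * n`! + exceptions d n) / INR n.-1)%coqR.
have := @poisson_zero_count 'S_n (nbad d (n := n)) (INR (d * d + d)) e (pos_INR _).
have -> : #|'S_n| = n`! by rewrite card_Sn.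
have E : (e <= 6496 * INR (d ^ 4) / INR n * INR n`!)%coqR.
  have h := error_bound d0 n6.
  have : (INR n * INR (d * d.+1 * (3 * d).+1 * n`! + exceptions d n) <=
    6496 * INR (d ^ 4) * INR n`! * INR n.-1)%coqR.
    have -> : 6496%coqR = (INR 2 * INR 3248)%coqR.
      by rewrite !INR_IZR_INZ -mult_IZR; congr IZR; lia.
    rewrite !Rmult_assoc -!mult_INR; apply: le_INR; apply/ssrnat.leP.
    by rewrite !multE !mulnA; rewrite !mulnA in h; exact: h.
  rewrite /e; move: (INR (_ + _)) => x hx.
  apply: (Rmult_le_reg_r (INR n * INR n.-1)); first by nra.
  have -> : (x / INR n.-1 * (INR n * INR n.-1) = INR n * x)%coqR by field; lra.
  have -> : (6496 * INR (d ^ 4) / INR n * INR n`! * (INR n * INR n.-1) =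
     6496 * INR (d ^ 4) * INR n`! * INR n.-1)%coqR by field; lra.
  by [].
move=> H.
have {}H : (Rabs (INR #|[set p : 'S_n | nbad d p == 0%N]| - exp (- INR (d * d + d)) * INR n`!) <= e)%coqR.
  apply: H => s [s0 s1].
  have s01 : (0 <= s <= 1)%R by apply/andP; split; apply/RleP.
  have n00 : (0 < n)%N by lia.
  have := stein_defect_le d n00 s01; move/RleP; rewrite -RabsE -!INRE => h.
  apply: (Rmult_le_reg_l (INR n.-1)) => //.
  have -> : (INR n.-1 * e = INR (d * d.+1 * (3 * d).+1 * n`! + exceptions d n))%coqR.
    by rewrite /e; field; lra.
  apply: Rle_trans h; apply: Req_le.
  rewrite -{1}(Rabs_right (INR n.-1)); last lra.
  rewrite -Rabs_mult; congr Rabs.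
  rewrite mult_INR dd.
  have -> : (\sum_(p : 'S_n) s ^+ nbad d p = \sum_(p : 'S_n) pow s (nbad d p))%R.
    by apply: eq_bigr => p _; rewrite RpowE.
  have -> : (\sum_(p : 'S_n) (nbad d p)%:R * s ^+ (nbad d p).-1 =
     \sum_(p : 'S_n) INR (nbad d p) * pow s (nbad d p).-1)%R.
    by apply: eq_bigr => p _; rewrite RpowE INRE.
  by rewrite -!RmultE -RminusE Rmult_minus_distr_l -Rmult_assoc (Rmult_comm (INR n.-1)).
have -> : prob_dist_ge n (d + 2) =
    (INR #|[set p : 'S_n | nbad d p == 0%N]| / INR n`!)%coqR.
  rewrite /prob_dist_ge cardsT card_Sn; congr (INR _ / _)%coqR.
  by apply: eq_card => p; rewrite !inE min_manhattan_geE.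
have {}H := Rle_trans _ _ _ H E.
apply: (Rmult_le_reg_r (INR n`!)) => //.
rewrite -[X in (_ * X <= _)%coqR](Rabs_right (INR n`!)); last lra.
rewrite -Rabs_mult.
set N0 := INR _ in H *; move: H.
have <- : ((N0 / INR n`! - exp (- INR (d * d + d))) * INR n`! =
  N0 - exp (- INR (d * d + d)) * INR n`!)%coqR by field; lra.
by [].
Qed.

(** Square d^2 <= lam <= 2 exp (lam / 2). *)
Lemma pow4_le_exp d : (INR (d ^ 4) <= 4 * exp (INR (d * d + d)))%coqR.
Proof.
have x0 := pos_INR d.
have -> : INR (d ^ 4) = (INR d * INR d * (INR d * INR d))%coqR.
  by rewrite -!mult_INR; congr INR; rewrite !expnS expn0; lia.
set l := INR (d * d + d).
have hl : (INR d * INR d <= l)%coqR.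
  by rewrite -mult_INR; apply: le_INR; lia.
have -> : exp l = (exp (l / 2) * exp (l / 2))%coqR.
  by rewrite -exp_plus; congr exp; field.
have h : (1 + l / 2 <= exp (l / 2))%coqR by apply: exp_ineq1_le.
nra.
Qed.

Lemma prob_dist_ge_01 n k : (0 <= prob_dist_ge n k <= 1)%coqR.
Proof.
rewrite /prob_dist_ge.
have h0 : (0 < INR #|[set: 'S_n]|)%coqR.
  by apply: lt_0_INR; rewrite cardsT card_Sn; have := fact_gt0 n; lia.
have h1 : (INR #|[set p : 'S_n | (k <= min_manhattan p)%N]| <= INR #|[set: 'S_n]|)%coqR.
  by apply: le_INR; apply/ssrnat.leP/subset_leq_card; rewrite subsetT.
split.
  by apply: Rmult_le_pos; [exact: pos_INR | exact/Rlt_le/Rinv_0_lt_compat].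
apply: (Rmult_le_reg_r _ _ _ h0).
by rewrite /Rdiv Rmult_assoc Rinv_l; lra.
Qed.

Theorem theorem1 (d : nat -> nat)
  (d_pos : forall n : nat, (0 < d n)%N)
  (d_log : exists C : R, exists N : nat, forall n : nat, (N <= n)%N ->
             Rle (INR (d n)) (Rmult C (ln (INR n)))) :
  exists K : R, exists N : nat, forall n : nat, (N <= n)%N ->
    let lam := INR (d n * d n + d n) in
    Rle (Rabs (Rminus (prob_dist_ge n (d n + 2)) (exp (Ropp lam))))
        (Rmult K (Rdiv (Rmult (pow (ln (INR n)) 6) (exp lam)) (INR n))).
Proof.
(* 25984 = 4 * 6496, with the 4 from [pow4_le_exp]. *)
exists 25984%coqR, 6 => n n6 lam.
have n6R : (6 <= INR n)%coqR.
  have -> : 6%coqR = INR 6 by rewrite /=; lra.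
  by apply: le_INR; apply/ssrnat.leP.
(* As n >= 6 > e, the power of the logarithm is at least 1, so a bound by a multiple of exp lam / n
   suffices. *)
have ln1 : (1 <= ln (INR n) ^ 6)%coqR.
  apply: pow_R1_Rle; rewrite -(ln_exp 1); apply/Rlt_le/ln_increasing; first exact: exp_pos.
  by have := exp_le_3; lra.
have eL := exp_pos lam.
have B : (exp lam / INR n <= ln (INR n) ^ 6 * exp lam / INR n)%coqR.
  apply: Rmult_le_compat_r; first by apply/Rlt_le/Rinv_0_lt_compat; lra.
  by nra.
suff H : (Rabs (prob_dist_ge n (d n + 2) - exp (- lam)) <= 25984 * (exp lam / INR n))%coqR.
  by apply: Rle_trans H _; apply: Rmult_le_compat_l; [lra | exact: B].
case: (leqP (d n).+2 (2 * n)) => hd.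
  apply: Rle_trans (prob_dist_ge_poisson (d_pos n) n6 hd) _.
  have := pow4_le_exp (d n); rewrite -/lam => h.
  rewrite /Rdiv -[X in Rle _ X]Rmult_assoc; apply: Rmult_le_compat_r; last by lra.
  by apply/Rlt_le/Rinv_0_lt_compat; lra.
(* Here [d n] exceeds [n], and the right-hand side is at least 1. *)
have nl : (INR n <= lam)%coqR by apply: le_INR; nia.
have h1 : (1 <= exp lam / INR n)%coqR.
  apply: (Rmult_le_reg_r (INR n)); first lra.
  have -> : (exp lam / INR n * INR n = exp lam)%coqR by field; lra.
  by have := exp_ineq1_le lam; lra.
have [p0 p1] := prob_dist_ge_01 n (d n + 2).
have e0 := exp_pos (- lam).
have e1 : (exp (- lam) <= 1)%coqR.
  by rewrite -exp_0; apply/Rlt_le/exp_increasing; lra.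
by apply: Rabs_le; lra.
Qed.
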